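(* Let $(E,d)$ be a reflexive geodesic space with convex metric and no bifurcating geodesics. Suppose $A\in P_{cp}(E)$. Then the set \[\mathcal{W}_{min}=\left\{X\in P_{b,cl,cv}^A(E) : \min(A,X)\text{ is well-posed}\right\}\] is a dense $G_\delta$-set in $P_{b,cl,cv}^A(E)$ (with respect to the Pompeiu-Hausdorff distance).
   Context: Let $(E,d)$ be a metric space. A geodesic path from $x$ to $y$ is a map $c:[0,l]\to E$ with $c(0)=x$, $c(l)=y$ and $d(c(t),c(t'))=|t-t'|$ for all $t,t'\in[0,l]$; its image is a geodesic segment joining $x$ and $y$. $E$ is a geodesic space if every two points are joined by a geodesic path. A subset $X\subseteq E$ is convex if every geodesic segment joining two points of $X$ is contained in $X$. The metric of a geodesic space is convex if for any geodesic paths $c_1:[0,l_1]\to E$, $c_2:[0,l_2]\to E$ with $c_1(0)=c_2(0)$ one has $d(c_1(tl_1),c_2(tl_2))\le t\,d(c_1(l_1),c_2(l_2))$ for all $t\in[0,1]$. A geodesic space is reflexive if every descending sequence of nonempty, bounded, closed and convex subsets has nonempty intersection. A space is without bifurcating geodesics if for any two geodesic segments with the same initial point and having another common point (different from the initial one), this second point is a common endpoint of both or one segment contains the other. $P_{cp}(E)$ is the family of nonempty compact subsets of $E$; $P_{b,cl,cv}(E)$ is the family of nonempty, bounded, closed, convex subsets of $E$, with the Pompeiu-Hausdorff distance $h(X,Y)=\max\{\sup_{x\in X}\mathrm{dist}(x,Y),\sup_{y\in Y}\mathrm{dist}(y,X)\}$, where $\mathrm{dist}(z,X)=\inf_{x\in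 X}d(z,x)$. For nonempty, bounded, closed sets $X,Y$ put $\lambda_{XY}=\inf\{d(x,y):x\in X,y\in Y\}$. For the fixed set $A$, $\lambda_X=\lambda_{XA}$ and \[P_{b,cl,cv}^A(E)=\overline{\{X\in P_{b,cl,cv}(E):\lambda_X>0\}},\] the closure being taken in $(P_{b,cl,cv}(E),h)$; it is equipped with $h$. The problem $\min(X,Y)$ consists in finding $(x_0,y_0)\in X\times Y$ (a solution) with $d(x_0,y_0)=\lambda_{XY}$. A minimizing sequence is a sequence $(x_n,y_n)$ in $X\times Y$ with $d(x_n,y_n)\to\lambda_{XY}$. The problem $\min(X,Y)$ is well-posed if it has a unique solution $(x_0,y_0)$ and every minimizing sequence $(x_n,y_n)$ satisfies $x_n\to x_0$ and $y_n\to y_0$. *)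

(* Defs.v *)
From HB Require Import structures.
From mathcomp Require Import all_boot all_order all_algebra.
From mathcomp Require Import all_classical all_reals all_analysis.

Set Implicit Arguments.
Unset Strict Implicit.
Unset Printing Implicit Defensive.

Import Order.TTheory GRing.Theory Num.Theory.
Import numFieldNormedType.Exports.

Local Open Scope classical_set_scope.
Local Open Scope ring_scope.

Section geodesics.
Context {R : realType} (E : metricType R).
Implicit Types (x y : E) (X S : set E) (c : R -> E) (l : R).

(* Only the values of [c] on [0, l] matter: a path is represented by any
   extension of it to the whole line. *)
Definition geodesic_path x y l c : Prop :=
  [/\ 0 <= l, c 0 = x, c l = y &
      forall t t' : R, `[0, l]%classic t -> `[0, l]%classic t' ->
        mdist (c t) (c t') = `|t - t'|].

Definition geodesic_segment x y S : Prop :=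
  exists l c, geodesic_path x y l c /\ S = c @` `[0, l]%classic.

Definition geodesic_space : Prop :=
  forall x y, exists l c, geodesic_path x y l c.

Definition geodesic_convex X : Prop :=
  forall x y S, X x -> X y -> geodesic_segment x y S -> S `<=` X.

Definition convex_metric : Prop :=
  forall x y1 y2 l1 l2 c1 c2,
    geodesic_path x y1 l1 c1 -> geodesic_path x y2 l2 c2 ->
    forall t : R, `[0, 1]%classic t ->
      mdist (c1 (t * l1)) (c2 (t * l2)) <= t * mdist (c1 l1) (c2 l2).

Definition no_bifurcating_geodesics : Prop :=
  forall x y1 y2 S1 S2 p,
    geodesic_segment x y1 S1 -> geodesic_segment x y2 S2 ->
    S1 p -> S2 p -> p <> x ->
    (p = y1 /\ p = y2) \/ (S1 `<=` S2 \/ S2 `<=` S1).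

Definition metric_bounded X : Prop :=
  exists M : R, forall x y, X x -> X y -> mdist x y <= M.

Definition P_cp : set (set E) := [set X | X !=set0 /\ compact X].

Definition P_b_cl_cv : set (set E) :=
  [set X | [/\ X !=set0, metric_bounded X, closed X & geodesic_convex X]].

Definition reflexive_space : Prop :=
  forall F : nat -> set E,
    (forall n, P_b_cl_cv (F n)) -> (forall n, F n.+1 `<=` F n) ->
    \bigcap_n F n !=set0.

End geodesics.

Arguments P_cp {R} E _.
Arguments P_b_cl_cv {R} E _.

Section distances.
Context {R : realType} {E : metricType R}.
Implicit Types (x y z : E) (X Y Z : set E).

(* [inf] and [sup] are real-valued, with junk values on empty or unbounded sets;
   these quantities are meaningful for nonempty bounded sets. *)
Definition dist_to z X : R := inf [set mdist z x | x in X].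

Definition hausdorff_dist X Y : R :=
  Num.max (sup [set dist_to x Y | x in X]) (sup [set dist_to y X | y in Y]).

Definition gap X Y : R := inf [set mdist x y | x in X & y in Y].

Lemma dist_to_le z X x : X x -> dist_to z X <= mdist z x.
Proof.
move=> Xx; apply: ge_inf; last by exists x.
by exists 0 => _ [y _ <-]; exact: mdist_ge0.
Qed.

Lemma dist_to_ge0 z X : X !=set0 -> 0 <= dist_to z X.
Proof.
move=> [x Xx]; apply: lb_le_inf; first by exists (mdist z x); exists x.
by move=> _ [y _ <-]; exact: mdist_ge0.
Qed.

Lemma dist_to_lt z X e : X !=set0 -> dist_to z X < e ->
  exists2 x, X x & mdist z x < e.
Proof.
move=> [x0 Xx0] ltXe.
have ne : [set mdist z x | x in X] !=set0 by exists (mdist z x0); exists x0.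
by have [_ [x Xx <-] ?] := inf_lt ne ltXe; exists x.
Qed.

Lemma dist_to_has_sup X Y : X !=set0 -> metric_bounded X -> Y !=set0 ->
  has_sup [set dist_to x Y | x in X].
Proof.
move=> [x0 Xx0] [M XM] [y0 Yy0]; split.
  by exists (dist_to x0 Y); exists x0.
exists (M + mdist x0 y0) => _ [x Xx <-].
apply: (le_trans (dist_to_le x Yy0)).
apply: (le_trans (metric_triangle x x0 y0)).
by rewrite lerD2r XM.
Qed.

Lemma hausdorff_dist_leP X Y e :
  X !=set0 -> metric_bounded X -> Y !=set0 -> metric_bounded Y ->
  hausdorff_dist X Y <= e <->
  (forall x, X x -> dist_to x Y <= e) /\ (forall y, Y y -> dist_to y X <= e).
Proof.
move=> X0 bX Y0 bY.
have [XY0 XYu] := dist_to_has_sup X0 bX Y0.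
have [YX0 YXu] := dist_to_has_sup Y0 bY X0.
rewrite /hausdorff_dist ge_max; split.
  move=> /andP[le1 le2]; split=> [x Xx|y Yy].
    by apply: le_trans le1; apply: ub_le_sup => //; exists x.
  by apply: le_trans le2; apply: ub_le_sup => //; exists y.
by move=> [le1 le2]; apply/andP; split; apply: ge_sup => // _ [x ? <-]; auto.
Qed.

Lemma dist_to_triangle x Y Z e : Y !=set0 ->
  (forall y, Y y -> dist_to y Z <= e) -> Z !=set0 ->
  dist_to x Z <= dist_to x Y + e.
Proof.
move=> Y0 YZ Z0; apply/ler_addgt0Pr => r r0.
have r2 : 0 < r / 2 by rewrite divr_gt0.
have [|y Yy xy] := @dist_to_lt x Y (dist_to x Y + r / 2) Y0.
  by rewrite ltrDl.
have [|z Zz yz] := @dist_to_lt y Z (e + r / 2) Z0.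
  by rewrite (le_lt_trans (YZ _ Yy))// ltrDl.
apply: (le_trans (dist_to_le x Zz)); apply: (le_trans (metric_triangle x y z)).
by rewrite [r]splitr addrACA lerD// ltW.
Qed.

End distances.

Section hyperspace.
Context {R : realType} (E : metricType R).

Record bclcv := Bclcv { bclcv_set :> set E ; bclcvP : P_b_cl_cv E bclcv_set }.

HB.instance Definition _ := gen_eqMixin bclcv.
HB.instance Definition _ := gen_choiceMixin bclcv.

Implicit Types X Y Z : bclcv.

Lemma bclcv_eq X Y : (X : set E) = Y -> X = Y.
Proof.
by case: X Y => [X PX] [Y PY] /= eXY; subst Y; congr Bclcv;
   exact: Prop_irrelevance.
Qed.

Lemma bclcv_neq0 X : (X : set E) !=set0. Proof. by case: X => X []. Qed.
Lemma bclcv_bounded X : metric_bounded (X : set E). Proof. by case: X => X []. Qed.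
Lemma bclcv_closed X : closed (X : set E). Proof. by case: X => X []. Qed.

Definition bclcv_dist X Y : R := hausdorff_dist X Y.

Lemma bclcv_dist_leP X Y e : bclcv_dist X Y <= e <->
  (forall x, (X : set E) x -> dist_to x Y <= e) /\
  (forall y, (Y : set E) y -> dist_to y X <= e).
Proof.
exact: (hausdorff_dist_leP _ (bclcv_neq0 X) (bclcv_bounded X)
  (bclcv_neq0 Y) (bclcv_bounded Y)).
Qed.

Lemma bclcv_dist_ge0 X Y : 0 <= bclcv_dist X Y.
Proof.
have [le1 _] := (bclcv_dist_leP X Y (bclcv_dist X Y)).1 (lexx _).
by have [x Xx] := bclcv_neq0 X;
   exact: le_trans (dist_to_ge0 x (bclcv_neq0 Y)) (le1 _ Xx).
Qed.

Lemma bclcv_distxx X : bclcv_dist X X = 0.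
Proof.
apply/eqP; rewrite eq_le bclcv_dist_ge0 andbT; apply/bclcv_dist_leP.
by split=> x Xx; rewrite (le_trans (dist_to_le x Xx))// mdistxx.
Qed.

Lemma dist_to_le0_in x X : dist_to x X <= 0 -> (X : set E) x.
Proof.
move=> d0; apply: bclcv_closed => B
  /metricType_numDomainType.nbhs_mdistP[e /= e0 eB].
have [|y Xy xy] := @dist_to_lt _ _ x X e (bclcv_neq0 X).
  exact: le_lt_trans e0.
by exists y; split=> //; exact: eB.
Qed.

Lemma bclcv_dist_positivity X Y : bclcv_dist X Y = 0 -> X = Y.
Proof.
move=> h0; have /bclcv_dist_leP[XY YX] : bclcv_dist X Y <= 0 by rewrite h0.
by apply: bclcv_eq; apply/seteqP; split=> x ?; apply: dist_to_le0_in; auto.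
Qed.

Lemma bclcv_dist_sym X Y : bclcv_dist X Y = bclcv_dist Y X.
Proof. by rewrite /bclcv_dist /hausdorff_dist maxC. Qed.

Lemma bclcv_dist_triangle Y X Z :
  bclcv_dist X Z <= bclcv_dist X Y + bclcv_dist Y Z.
Proof.
have [XY YX] := (bclcv_dist_leP X Y _).1 (lexx _).
have [YZ ZY] := (bclcv_dist_leP Y Z _).1 (lexx _).
apply/bclcv_dist_leP; split=> [x Xx|z Zz].
  by rewrite (le_trans (dist_to_triangle x (bclcv_neq0 Y) YZ (bclcv_neq0 Z)))//
    lerD2r XY.
rewrite (le_trans (dist_to_triangle z (bclcv_neq0 Y) YX (bclcv_neq0 X)))//.
by rewrite addrC lerD2l ZY.
Qed.

HB.instance Definition _ :=
  isMetric.Build R bclcv bclcv_distxx bclcv_dist_positivity bclcv_dist_sym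
    bclcv_dist_triangle.

Lemma bclcv_mdistE X Y : mdist X Y = hausdorff_dist X Y.
Proof. by []. Qed.

End hyperspace.

(* [closure] is taken in the Pompeiu-Hausdorff metric on [bclcv E]; coerced to a
   type, [P_b_cl_cv_A A] carries the subspace topology. *)
Definition P_b_cl_cv_A {R : realType} {E : metricType R} (A : set E) :
    set (bclcv E) :=
  closure [set X : bclcv E | 0 < gap X A].

Arguments P_b_cl_cv_A {R E} A _.

Section min_problem.
Context {R : realType} {E : metricType R}.
Implicit Types X Y : set E.

Definition min_solution X Y : set (E * E) :=
  [set p | [/\ X p.1, Y p.2 & mdist p.1 p.2 = gap X Y]].

Definition minimizing_sequence X Y (u v : nat -> E) : Prop :=
  [/\ forall n, X (u n), forall n, Y (v n) &
      mdist (u n) (v n) @[n --> \oo] --> gap X Y].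

Definition min_well_posed X Y : Prop :=
  exists p : E * E,
    [/\ min_solution X Y p,
        forall q, min_solution X Y q -> q = p &
        forall u v, minimizing_sequence X Y u v ->
          u @ \oo --> p.1 /\ v @ \oo --> p.2].

Definition W_min (A : set E) : set (P_b_cl_cv_A A) :=
  [set X | min_well_posed A (set_val X : bclcv E)].

End min_problem.

Arguments W_min {R E} A _.

(* Main.v *)
(* Well-posedness of min(A, X) means that a solution exists, which compactness
   of A and reflexivity provide for every X, and that the sets of almost
   minimizing pairs have arbitrarily small diameter. For a fixed size this last
   condition is, up to a factor 2, stable under small Hausdorff perturbations of
   X, whence the G-delta property. For density, let (a0, x0) solve min(A, X) with
   positive gap, and push out X slightly towards a point u of the geodesic from
   x0 to a0: minimizing sequences of the new set are forced to u, and a0 is the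
   only nearest point of u in A, since another one would bifurcate at u from the
   geodesic from x0 to a0. *)
Require Import Defs.
From mathcomp Require Import all_boot all_order all_algebra.
From mathcomp Require Import all_classical all_reals all_analysis.
From mathcomp Require Import borel_hierarchy.
From mathcomp Require Import lra.

Set Implicit Arguments.
Unset Strict Implicit.
Unset Printing Implicit Defensive.

Import Order.TTheory GRing.Theory Num.Theory.
Import numFieldNormedType.Exports.

Local Open Scope classical_set_scope.
Local Open Scope ring_scope.

(** * Geodesic paths and functions convex along them *)

Section geodesic_convexity.
Context {R : realType} {E : metricType R}.
Implicit Types (x y u : E) (X Y S : set E) (c : R -> E) (l t : R) (f : E -> R).

Lemma geodesic_path_mdist x y l c : geodesic_path x y l c -> mdist x y = l.
Proof.
move=> [l0 <- <- cd]; rewrite cd/= ?in_itv/= ?lexx ?l0//.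
by rewrite sub0r normrN ger0_norm.
Qed.

Lemma geodesic_path_rev x y l c :
  geodesic_path x y l c -> geodesic_path y x l (fun t => c (l - t)).
Proof.
move=> [l0 c0 cl cd]; split=> //; rewrite ?subr0 ?subrr//.
move=> t t'; rewrite /= !in_itv/= => /andP[t0 tl] /andP[t'0 t'l].
rewrite cd/= ?in_itv/=; first by rewrite distrC; congr `|_|; lra.
all: by lra.
Qed.

Lemma geodesic_path_in x y l c t : geodesic_path x y l c -> 0 <= t <= 1 ->
  0 <= t * l <= l.
Proof. by move=> [l0 _ _ _] t01; rewrite mulr_ge0 ?ler_piMl//; lra. Qed.

Lemma geodesic_path_mdistl x y l c t : geodesic_path x y l c -> 0 <= t <= 1 ->
  mdist x (c (t * l)) = t * l.
Proof.
move=> cP t01; have := geodesic_path_in cP t01.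
case: cP => [l0 <- _ cd] tl.
rewrite cd/= ?in_itv/= ?lexx//.
by rewrite sub0r normrN ger0_norm//; case/andP: tl.
Qed.

Lemma geodesic_path_take x y l c r : geodesic_path x y l c -> 0 <= r <= l ->
  geodesic_path x (c r) r c.
Proof.
move=> [l0 c0 cl cd] /andP[r0 rl]; split=> // t t'.
rewrite /= !in_itv/= => /andP[t0 tr] /andP[t'0 t'r].
by apply: cd; rewrite /= in_itv/= ?t0 ?t'0 (le_trans _ rl).
Qed.

Lemma geodesic_path_split x y l c t : geodesic_path x y l c -> 0 <= t <= l ->
  mdist x (c t) = t /\ mdist (c t) y = l - t.
Proof.
move=> cP tl; split.
  exact: geodesic_path_mdist (geodesic_path_take cP tl).
have tl' : 0 <= l - t <= l by lra.
have := geodesic_path_mdist (geodesic_path_take (geodesic_path_rev cP) tl').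
by rewrite opprB addrC subrK metric_sym.
Qed.

(** For points on different pieces, the triangle inequality through [y] bounds their distance above.
    It cannot be smaller, since the route from [x] to [z] through both points has length at least
    [l1 + l2]. *)
Lemma geodesic_path_cat x y z l1 l2 c1 c2 :
  geodesic_path x y l1 c1 -> geodesic_path y z l2 c2 ->
  mdist x z = l1 + l2 ->
  geodesic_path x z (l1 + l2) (fun t => if t <= l1 then c1 t else c2 (t - l1)).
Proof.
move=> c1P c2P xz; have [l10 c10 c1l d1] := c1P; have [l20 c20 c2l d2] := c2P.
split; [lra|by rewrite l10| |].
  case: ifPn => [h|_]; last by rewrite addrC addKr.
  have l2E : l2 = 0 by lra.
  by rewrite l2E addr0 c1l -c20 -c2l l2E.
move=> t t'; wlog tt' : t t' / t <= t' => [H t0 t'0|].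
  have [/H|/ltW /H] := leP t t'; first exact.
  by rewrite metric_sym distrC; exact.
rewrite /= !in_itv/= => /andP[t0 tl] /andP[t'0 t'l].
case: (leP t l1) => [tl1|l1t]; case: (leP t' l1) => [t'l1|l1t'].
- by rewrite d1//= in_itv/= ?t0 ?t'0.
- have [xt ty] : mdist x (c1 t) = t /\ mdist (c1 t) y = l1 - t.
    by apply: (geodesic_path_split c1P); rewrite t0.
  have [yt' t'z] : mdist y (c2 (t' - l1)) = t' - l1 /\
      mdist (c2 (t' - l1)) z = l2 - (t' - l1).
    by apply: (geodesic_path_split c2P); lra.
  rewrite distrC ger0_norm ?subr_ge0//.
  have := metric_triangle (c1 t) y (c2 (t' - l1)).
  have := metric_triangle x (c1 t) z.
  have := metric_triangle (c1 t) (c2 (t' - l1)) z.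
  lra.
- by lra.
- rewrite d2/= ?in_itv/=; first by congr `|_|; lra.
  + by lra.
  + by lra.
Qed.

Lemma geodesic_segment_end x y z S : geodesic_segment x y S -> S z ->
  mdist x z = mdist x y -> z = y.
Proof.
move=> [l [c [cP ->]]] [t + <-]; rewrite /= in_itv/= => tl.
have czP := geodesic_path_take cP tl.
rewrite (geodesic_path_mdist cP) (geodesic_path_mdist czP).
by move=> ->; case: cP.
Qed.

Definition convex_along_geodesics f := forall x y l c,
  geodesic_path x y l c ->
  forall t, 0 <= t <= 1 -> f (c (t * l)) <= (1 - t) * f x + t * f y.

Lemma convex_along_geodesicsD f g : convex_along_geodesics f ->
  convex_along_geodesics g -> convex_along_geodesics (fun x => f x + g x).
Proof.
move=> cf cg x y l c cP t t01; have := cf _ _ _ _ cP _ t01.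
by have := cg _ _ _ _ cP _ t01; lra.
Qed.

Lemma convex_along_geodesicsM f k : 0 <= k -> convex_along_geodesics f ->
  convex_along_geodesics (fun x => k * f x).
Proof.
move=> k0 cf x y l c cP t t01.
by have := ler_wpM2l k0 (cf _ _ _ _ cP _ t01); lra.
Qed.

Lemma sublevel_geodesic_convex f r : convex_along_geodesics f ->
  geodesic_convex [set x | f x <= r].
Proof.
move=> cf x y _ /= fx fy [l [c [cP ->]]] _ [s + <-]; rewrite /= in_itv/= => sl.
(* Rescaling the parameter to [s / l] requires a nondegenerate path. *)
have [l0|l0] := eqVneq l 0.
  have -> : s = 0 by lra.
  by case: cP => _ ->.
have lgt0 : 0 < l by rewrite lt_neqAle eq_sym l0/=; case: cP.
have sl01 : 0 <= s / l <= 1.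
  case/andP: sl => s0 sl.
  by rewrite divr_ge0 ?(ltW lgt0)// ler_pdivrMr// mul1r.
have := cf _ _ _ _ cP _ sl01; rewrite divfK// => /le_trans; apply.
set t := s / l in sl01 *.
have : (1 - t) * f x <= (1 - t) * r by rewrite ler_wpM2l//; lra.
have : t * f y <= t * r by rewrite ler_wpM2l//; lra.
lra.
Qed.

Lemma geodesic_convexI X Y : geodesic_convex X -> geodesic_convex Y ->
  geodesic_convex (X `&` Y).
Proof.
move=> cX cY x y S [Xx Yx] [Xy Yy] gS s Ss.
by split; [exact: (cX x y S)|exact: (cY x y S)].
Qed.

Hypotheses (geodE : geodesic_space E) (convE : convex_metric E).

(** The metric hypothesis compares [c] with a geodesic [c'] from [x] to [u]: [c (t * l)] is within
    [t * mdist y u] of [c' (t * l')], which lies at distance [(1 - t) * mdist x u] from [u]. *)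
Lemma mdist_convex u : convex_along_geodesics (fun x => mdist x u).
Proof.
move=> x y l c cP t t01.
have [l' [c' c'P]] := geodE x u.
have := convE cP c'P t01.
have t01' : 0 <= 1 - t <= 1 by lra.
have := geodesic_path_mdistl (geodesic_path_rev c'P) t01'.
have -> : l' - (1 - t) * l' = t * l' by lra.
rewrite -[in X in _ = X](geodesic_path_mdist c'P) metric_sym => d1.
case: cP => _ _ ->; case: c'P => _ _ -> _ d2.
by have := metric_triangle (c (t * l)) (c' (t * l')) u; lra.
Qed.

(** With almost nearest points [x'], [y'] in [X], the diagonal from [x] to [y'] cuts the
    quadrilateral into two triangles. Metric convexity applies to one from [x], and to the other
    from [y'] with both paths reversed. *)
Lemma dist_to_convex X : X !=set0 -> geodesic_convex X ->
  convex_along_geodesics (fun x => dist_to x X).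
Proof.
move=> X0 cX x y l c cP t t01; apply/ler_addgt0Pr => e e0.
have [|x' Xx' xx'] := @dist_to_lt _ _ x X (dist_to x X + e) X0.
  by rewrite ltrDl.
have [|y' Xy' yy'] := @dist_to_lt _ _ y X (dist_to y X + e) X0.
  by rewrite ltrDl.
have [l1 [c1 c1P]] := geodE x y'; have [l2 [c2 c2P]] := geodE x' y'.
have t01' : 0 <= 1 - t <= 1 by lra.
have Xz : X (c2 (t * l2)).
  apply: (cX x' y' (c2 @` `[0, l2]%classic)) => //; first by exists l2, c2.
  by exists (t * l2) => //=; rewrite in_itv/= (geodesic_path_in c2P).
have := convE cP c1P t01.
have := convE (geodesic_path_rev c1P) (geodesic_path_rev c2P) t01'.
have rv a : a - (1 - t) * a = t * a by lra.
rewrite !rv !subrr.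
have [_ _ -> _] := cP; have [_ -> -> _] := c1P; have [_ -> _ _] := c2P => d1 d2.
apply: (le_trans (dist_to_le _ Xz)).
apply: (le_trans (metric_triangle _ (c1 (t * l1)) _)).
have [t0 t1] := andP t01; have [t0' t1'] := andP t01'.
by have := ler_wpM2l t0' (ltW xx'); have := ler_wpM2l t0 (ltW yy'); lra.
Qed.

End geodesic_convexity.

(** * Lipschitz functions and their closed sublevel sets *)

Section lipschitz.
Context {R : realType} {E : metricType R}.
Implicit Types (x y u : E) (X : set E) (f : E -> R).

Lemma dist_to_lipschitz x y X : X !=set0 ->
  dist_to x X <= dist_to y X + mdist x y.
Proof.
move=> X0; apply/ler_addgt0Pr => e e0.
have [|z Xz yz] := @dist_to_lt _ _ y X (dist_to y X + e) X0.
  by rewrite ltrDl.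
apply: (le_trans (dist_to_le x Xz)).
by have := metric_triangle x y z; lra.
Qed.

Lemma lipschitz1_continuous f :
  (forall x y, f x <= f y + mdist x y) -> continuous f.
Proof.
move=> lf x; apply/cvgrPdist_lt => e e0; 
apply/metricType_numDomainType.nbhs_mdistP; exists e => // y /= xy.
rewrite ltr_norml.
by have := lf x y; have := lf y x; rewrite [mdist y x]metric_sym; lra.
Qed.

Lemma continuous_mdistl u : continuous (fun x => mdist x u).
Proof.
by apply: lipschitz1_continuous => x y; rewrite addrC; exact: metric_triangle.
Qed.

Lemma continuous_dist_to X : X !=set0 -> continuous (fun x => dist_to x X).
Proof.
by move=> X0; apply: lipschitz1_continuous => x y; exact: dist_to_lipschitz.
Qed.

Lemma sublevel_closed f (r : R) : continuous f -> closed [set x | f x <= r].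
Proof.
move=> cf; apply: (@closed_comp _ _ f [set y | y <= r]) => [x _|].
  exact: cf.
exact: closed_le.
Qed.

End lipschitz.

(** * The gap between sets and its dependence on the Hausdorff distance *)

Section gap.
Context {R : realType} {E : metricType R}.
Implicit Types (x y u : E) (X Y A : set E).

Lemma gap_le X Y x y : X x -> Y y -> gap X Y <= mdist x y.
Proof.
move=> Xx Yy; apply: ge_inf; last by exists x => //; exists y.
by exists 0 => _ [x' _ [y' _ <-]]; exact: mdist_ge0.
Qed.

Lemma lb_le_gap X Y (r : R) : X !=set0 -> Y !=set0 ->
  (forall x y, X x -> Y y -> r <= mdist x y) -> r <= gap X Y.
Proof.
move=> [x Xx] [y Yy] rXY; apply: lb_le_inf.
  by exists (mdist x y), x => //; exists y.
by move=> _ [x' ? [y' ? <-]]; exact: rXY.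
Qed.

Lemma gap_sym X Y : gap X Y = gap Y X.
Proof.
congr inf; apply/seteqP; split=> _ [x ? [y ? <-]];
  by exists y => //; exists x => //; rewrite metric_sym.
Qed.

Lemma gap_le_dist_to X Y x : X x -> Y !=set0 -> gap X Y <= dist_to x Y.
Proof.
move=> Xx [y Yy]; apply: lb_le_inf; first by exists (mdist x y), y.
by move=> _ [z ? <-]; exact: gap_le.
Qed.

Lemma gap_hausdorff A (X Y : bclcv E) : A !=set0 ->
  gap A Y <= gap A X + mdist X Y.
Proof.
move=> A0; rewrite -lerBlDr; apply: lb_le_gap => //; first exact: bclcv_neq0.
move=> a x Aa Xx; rewrite lerBlDr.
have [XY _] := (bclcv_dist_leP X Y _).1 (lexx _).
apply: (le_trans (gap_le_dist_to Aa (bclcv_neq0 Y))).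
apply: (le_trans (dist_to_lipschitz a x (bclcv_neq0 Y))).
by rewrite addrC lerD2l; exact: XY.
Qed.

End gap.

(** * Existence of solutions *)

Section min_problem.
Context {R : realType} {E : metricType R}.
Hypotheses (geodE : geodesic_space E) (convE : convex_metric E).
Hypothesis reflE : reflexive_space E.
Implicit Types (X Y : bclcv E) (A : set E) (a x : E).

(** Reflexivity applies to the intersections of [X] with shrinking closed balls around [a], whose
    radii exceed the distance by [1/(n+1)] so that none is empty. *)
Lemma dist_to_attained a X : exists2 x, (X : set E) x & mdist a x = dist_to a X.
Proof.
have [X0 bX clX cX] := bclcvP X.
pose F n := (X : set E) `&` [set x | mdist x a <= dist_to a X + n.+1%:R^-1].
have [n|n x [Xx xa]|x Fx] := reflE (F := F).
- split.
  + have [|x Xx ax] := @dist_to_lt _ _ a X (dist_to a X + n.+1%:R^-1) X0.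
      by rewrite ltrDl invr_gt0.
    by exists x; split=> //=; rewrite metric_sym ltW.
  + by have [M XM] := bX; exists M => x y [? _] [? _]; exact: XM.
  + by apply: closedI => //; apply: sublevel_closed; exact: continuous_mdistl.
  + apply: geodesic_convexI => //; apply: sublevel_geodesic_convex.
    exact: mdist_convex.
- by split=> //=; rewrite (le_trans xa)// lerD2l lef_pV2 ?posrE ?ler_nat.
exists x; first by have [] := Fx 0%N I.
apply/eqP; rewrite eq_le dist_to_le ?andbT; last by have [] := Fx 0%N I.
apply/ler_addgt0Pr => e e0.
have [n ne] : exists n, n.+1%:R^-1 < e.
  by have [n _ /(_ n (leqnn n))] := near_infty_natSinv_lt (PosNum e0); exists n.
by have [_ /=] := Fx n I; rewrite metric_sym => /le_trans; apply;
   rewrite lerD2l ltW.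
Qed.

Lemma min_solution_exists A X : P_cp E A -> min_solution A X !=set0.
Proof.
move=> [A0 cA].
have [|a /set_mem Aa amin] := compact_EVT_min (f := fun a => dist_to a X) A0 cA.
  by apply: continuous_subspaceT; apply: continuous_dist_to; exact: bclcv_neq0.
have [x Xx ax] := dist_to_attained a X.
exists (a, x); split=> //=; apply/eqP; rewrite eq_le gap_le// andbT ax.
apply: lb_le_gap => //; first exact: bclcv_neq0.
move=> a' x' Aa' Xx'; apply: le_trans (dist_to_le a' Xx').
by apply: amin; rewrite inE.
Qed.

End min_problem.

(** * Well-posedness through diameters of almost minimizing sets *)

Section well_posedness.
Context {R : realType} {E : metricType R}.
Implicit Types (X Y : bclcv E) (A : set E) (a x u : E) (e h : R).

Definition near_min_small A (X : set E) h := exists2 e, 0 < e &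
  forall a a' x x', A a -> A a' -> X x -> X x' ->
    mdist a x <= gap A X + e -> mdist a' x' <= gap A X + e ->
    mdist a a' < h /\ mdist x x' < h.

(** Otherwise there are [1/(n+1)]-minimizing pairs that stay away from the solution; they form a
    minimizing sequence that does not converge to it. *)
Lemma well_posed_near_min_small A X h : min_well_posed A X -> 0 < h ->
  near_min_small A X h.
Proof.
move=> [p [[Ap Xp dp] _ cp]] h0.
have h20 : 0 < h / 2 by rewrite divr_gt0.
have [n nP] : exists n : nat, forall a x, A a -> (X : set E) x ->
    mdist a x <= gap A X + n.+1%:R^-1 ->
    mdist p.1 a < h / 2 /\ mdist p.2 x < h / 2.
  apply: contrapT => /forallNP H.
  have {}H : forall n : nat, exists q : E * E, [/\ A q.1, (X : set E) q.2,
      mdist q.1 q.2 <= gap A X + n.+1%:R^-1 &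
      ~ (mdist p.1 q.1 < h / 2 /\ mdist p.2 q.2 < h / 2)].
    move=> n; apply: contrapT => /forallNP Hn; apply: (H n) => a x Aa Xx ax.
    by apply: contrapT => far; apply: (Hn (a, x)).
  have [q qP] := choice H.
  have [|cu cv] := cp (fst \o q) (snd \o q).
    split=> [n|n|]; [by have [] := qP n|by have [] := qP n|].
    apply/cvgrPdist_lt => e e0.
    apply: filterS (near_infty_natSinv_lt (PosNum e0)) => n /= ne.
    have [Aq Xq dq _] := qP n; have gq := gap_le Aq Xq.
    by rewrite distrC ger0_norm ?subr_ge0// ltrBlDl (le_lt_trans dq)// ltrD2l.
  have /metricType_numDomainType.cvgrPdist_lt/(_ _ h20) nu := cu.
  have /metricType_numDomainType.cvgrPdist_lt/(_ _ h20) nv := cv.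
  have [n [un vn]] := filter_ex (filterI nu nv).
  by have [_ _ _] := qP n; apply.
exists n.+1%:R^-1 => // a a' x x' Aa Aa' Xx Xx' ax ax'.
have [pa px] := nP _ _ Aa Xx ax; have [pa' px'] := nP _ _ Aa' Xx' ax'.
have := metric_triangle a p.1 a'; have := metric_triangle x p.2 x'.
by rewrite [mdist a p.1]metric_sym [mdist x p.2]metric_sym; split; lra.
Qed.

(** A solution is itself almost minimizing for every tolerance, so any other solution and the tail
    of any minimizing sequence lie within [h] of it. *)
Lemma near_min_small_well_posed A X : min_solution A X !=set0 ->
  (forall h, 0 < h -> near_min_small A X h) -> min_well_posed A X.
Proof.
move=> [p [Ap Xp dp]] smallX; exists p; split=> //.
  move=> q [Aq Xq dq]; suff : forall h, 0 < h ->
      mdist p.1 q.1 < h /\ mdist p.2 q.2 < h.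
    move=> pq; have [pq1 pq2] : mdist p.1 q.1 = 0 /\ mdist p.2 q.2 = 0.
      by split; apply/eqP; rewrite eq_le mdist_ge0 andbT;
        apply/ler_addgt0Pr => h h0; rewrite add0r ltW//; have [] := pq _ h0.
    have := mdist_positivity _ _ pq1; have := mdist_positivity _ _ pq2.
    by case: (p) (q) => [? ?] [? ?] /= -> ->.
  move=> h h0; have [e e0] := smallX h h0.
  by apply=> //; rewrite ?dp ?dq lerDl ltW.
move=> u v [Au Xv uv].
suff : forall h, 0 < h -> \forall n \near \oo,
    mdist p.1 (u n) < h /\ mdist p.2 (v n) < h.
  move=> puv; split; apply/metricType_numDomainType.cvgrPdist_lt => h h0;
    by apply: filterS (puv _ h0) => n [].
move=> h h0; have [e e0 eP] := smallX h h0.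
have /cvgrPdist_lt/(_ _ e0) := uv; apply: filterS => n.
rewrite ltr_norml => /andP[uvn _]; apply: eP => //.
  by rewrite dp lerDl ltW.
by lra.
Qed.

Lemma near_min_small_nbhs A X h : A !=set0 -> 0 < h ->
  near_min_small A X (h / 2) ->
  nbhs X [set Y : bclcv E | near_min_small A Y h].
Proof.
move=> A0 h0 [e e0 eP].
apply/metricType_numDomainType.nbhs_mdistP.
(* Replacing a point of [Y] by one of [X] costs [d] in the distance and [d] in the gap, and
   [e / 2 + 2 * d <= e]; it adds [2 * d <= h / 2] to the diameter. *)
pose d := Num.min (e / 4) (h / 4).
have d0 : 0 < d by rewrite lt_min !divr_gt0.
have [de dh] : d <= e / 4 /\ d <= h / 4 by split; rewrite ge_min lexx ?orbT.
exists d => // Y /= XY; exists (e / 2); first by rewrite divr_gt0.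
have gYX := gap_hausdorff X Y A0.
have [_ YX] := (bclcv_dist_leP X Y _).1 (lexx _).
have close a y : (Y : set E) y -> mdist a y <= gap A Y + e / 2 ->
    exists x, [/\ (X : set E) x, mdist a x <= gap A X + e & mdist y x < d].
  move=> Yy ay; have [|x Xx yx] := @dist_to_lt _ _ y X d (bclcv_neq0 X).
    exact: le_lt_trans (YX _ Yy) XY.
  by exists x; split=> //; have := metric_triangle a y x; lra.
move=> a a' y y' Aa Aa' Yy Yy' ay ay'.
have [x [Xx ax yx]] := close _ _ Yy ay.
have [x' [Xx' ax' yx']] := close _ _ Yy' ay'.
have [aa' xx'] := eP _ _ _ _ Aa Aa' Xx Xx' ax ax'.
split; first by lra.
have := metric_triangle y x y'; have := metric_triangle x x' y'.
by rewrite [mdist x' y']metric_sym; lra.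
Qed.

(** On the compact part [B] of [A] at distance at least [h] from [a0], the distance to [u] attains a
    minimum, which exceeds [mdist a0 u] by uniqueness. *)
Lemma unique_nearest_stable A u a0 h : compact A -> A a0 ->
  (forall a, A a -> mdist a u <= mdist a0 u -> a = a0) -> 0 < h ->
  exists2 e, 0 < e &
    forall a, A a -> mdist a u <= mdist a0 u + e -> mdist a0 a < h.
Proof.
move=> cA Aa0 uniq_a0 h0.
pose B := A `&` [set a | h <= mdist a a0].
have cB : compact B.
  apply: compact_closedI => //.
  apply: (@closed_comp _ _ (mdist^~ a0) [set r | h <= r]) => [x _|].
    exact: continuous_mdistl.
  exact: closed_ge.
have [B0|/set0P B0] := eqVneq B set0; last first.
  have [|b /set_mem[Ab hb] bmin] :=
      compact_EVT_min (f := fun a => mdist a u) B0 cB.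
    by apply: continuous_subspaceT; exact: continuous_mdistl.
  have ltb : mdist a0 u < mdist b u.
    rewrite ltNge; apply/negP => /(uniq_a0 _ Ab) ba0.
    by move: hb; rewrite /= ba0 mdistxx leNgt h0.
  exists ((mdist b u - mdist a0 u) / 2); first by rewrite divr_gt0 ?subr_gt0.
  move=> a Aa au; rewrite ltNge; apply/negP => ha.
  have : mdist b u <= mdist a u by apply: bmin; rewrite inE; split;
    rewrite //= metric_sym.
  by lra.
exists 1 => // a Aa _; rewrite ltNge; apply/negP => ha.
suff : B a by rewrite B0.
by split; rewrite //= metric_sym.
Qed.

End well_posedness.

(** * Perturbing a set into a well-posed one *)

Section perturbation.
Context {R : realType} {E : metricType R}.
Hypotheses (geodE : geodesic_space E) (convE : convex_metric E).
Hypotheses (reflE : reflexive_space E) (nobifE : no_bifurcating_geodesics E).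
Implicit Types (X Y : bclcv E) (A : set E) (a x u : E) (l r : R).

(** A path from [x] through [u] to [b] has the length [mdist x b], hence is geodesic, and it meets
    [c] at [u]. Without bifurcation one segment contains the other, and equal lengths identify the
    endpoints. *)
Lemma geodesic_path_extend_unique x u a b l r c :
  geodesic_path x a l c -> 0 < r < l -> u = c r ->
  mdist x b = l -> mdist u b = l - r -> b = a.
Proof.
move=> cP /andP[r0 rl] uE xb ub.
have rl' : 0 <= r <= l by rewrite !ltW.
have [xu ua] := geodesic_path_split cP rl'; rewrite -uE in xu ua.
have [l2 [c2 c2P]] := geodE u b.
have l2E : l2 = l - r by rewrite -(geodesic_path_mdist c2P).
have c1P := geodesic_path_take cP rl'; rewrite -uE in c1P.
have xb' : mdist x b = r + l2 by lra.
have c3P := geodesic_path_cat c1P c2P xb'.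
set c3 := (fun t => _) in c3P.
have gc : geodesic_segment x a (c @` `[0, l]%classic) by exists l, c.
have gc3 : geodesic_segment x b (c3 @` `[0, r + l2]%classic).
  by exists (r + l2), c3.
have xa := geodesic_path_mdist cP.
have ux : u <> x by move=> ux; move: xu; rewrite ux mdistxx; lra.
have cu : (c @` `[0, l]%classic) u by exists r => //=; rewrite in_itv/= rl'.
have c3u : (c3 @` `[0, r + l2]%classic) u.
  by exists r; rewrite /= ?in_itv/= /c3 ?lexx//; lra.
have ca : (c @` `[0, l]%classic) a.
  by exists l; [rewrite /= in_itv/=; lra|case: cP].
have c3b : (c3 @` `[0, r + l2]%classic) b.
  by exists (r + l2); [rewrite /= in_itv/=; lra|case: c3P].
have [[ua0 _]|[sub|sub]] := nobifE gc gc3 cu c3u ux.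
- by move: rl; rewrite -subr_gt0 -ua ua0 mdistxx ltxx.
- by apply/esym/(geodesic_segment_end gc3 (sub _ ca)); rewrite xa xb.
- by apply: (geodesic_segment_end gc (sub _ c3b)); rewrite xa xb.
Qed.

(* With (a0, x0) a solution of min(A, X) and u at distance r from x0 on the
   geodesic from x0 to a0, the new set is a sublevel set of the convex function
   y |-> dist(y, X) + k d(y, u). It replaces the closed convex hull of X and u,
   and the term k d(y, u) directly forces minimizing sequences towards u. *)
Lemma well_posed_perturbation A X r : P_cp E A -> 0 < r < gap A X ->
  exists Y, [/\ mdist X Y <= r, 0 < gap A Y & min_well_posed A Y].
Proof.
move=> cpA /andP[r0 rl]; have [A0 cA] := cpA.
have [[a0 x0] [/= Aa0 Xx0]] := min_solution_exists geodE convE reflE X cpA.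
set l := gap A X in rl * => a0x0.
have [X0 [M0 XM] clX cX] := bclcvP X.
have [l' [c cP]] := geodE x0 a0.
have l'E : l' = l by rewrite -(geodesic_path_mdist cP) metric_sym.
rewrite {l'}l'E in cP.
pose u := c r.
have [x0u ua0] : mdist x0 u = r /\ mdist u a0 = l - r.
  by apply: (geodesic_path_split cP); rewrite !ltW.
pose M := M0 + r.
have M0r : 0 < M.
  by have := XM _ _ Xx0 Xx0; rewrite mdistxx /M; lra.
have XuM x : (X : set E) x -> mdist x u <= M.
  move=> Xx; have := metric_triangle x x0 u.
  by have := XM _ _ Xx Xx0; rewrite /M; lra.
(* As [M] bounds the distances from [u] to points of [X], this weight keeps [X] inside the sublevel
   set at height [r]. *)
pose k := r / M.
have k0 : 0 < k by rewrite divr_gt0.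
have kM : k * M = r by rewrite divfK// gt_eqF.
pose f y := dist_to y X + k * mdist y u.
have f_conv : convex_along_geodesics f.
  apply: convex_along_geodesicsD; first exact: dist_to_convex.
  by apply: convex_along_geodesicsM; [exact: ltW|exact: mdist_convex].
have f_cont : continuous f.
  move=> y; apply: cvgD; first exact: continuous_dist_to.
  by apply: cvgM; [exact: cvg_cst|exact: continuous_mdistl].
have fX x : (X : set E) x -> f x <= r.
  move=> Xx; have := dist_to_le x Xx; have := ler_wpM2l (ltW k0) (XuM _ Xx).
  by rewrite mdistxx /f; lra.
have fu : f u <= r.
  have := dist_to_le u Xx0.
  by rewrite /f mdistxx [mdist u x0]metric_sym; lra.
have YP : P_b_cl_cv E [set y | f y <= r].
  split; [by exists u| | |].
  - exists (M + M) => y z /= fy fz.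
    have yM w : f w <= r -> mdist w u <= M.
      move=> fw; rewrite -(ler_pM2l k0) kM.
      by have := dist_to_ge0 w X0; move: fw; rewrite /f; lra.
    have := metric_triangle y u z; rewrite [mdist u z]metric_sym.
    by have := yM _ fy; have := yM _ fz; lra.
  - exact: sublevel_closed.
  - exact: sublevel_geodesic_convex.
pose Y := Bclcv YP.
(* The distance to [X] is 1-Lipschitz and at least [l] on [A]. The term in [k] is the excess that
   penalizes points away from [u]. *)
have fA a y : A a -> f y <= r -> l - r + k * mdist y u <= mdist a y.
  move=> Aa; have := gap_le_dist_to Aa X0; rewrite -/l.
  by have := dist_to_lipschitz a y X0; rewrite /f; lra.
have gapY : gap A Y = l - r.
  apply/eqP; rewrite eq_le; apply/andP; split.
    by rewrite -ua0 metric_sym; exact: gap_le.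
  apply: lb_le_gap => //; first by exists u.
  move=> a y Aa fy; have := fA _ _ Aa fy.
  by have := mulr_ge0 (ltW k0) (mdist_ge0 y u); lra.
have XY : mdist X Y <= r.
  apply/bclcv_dist_leP; split=> [x Xx|y /= fy].
    have Yx : (Y : set E) x by exact: fX.
    by apply: le_trans (dist_to_le x Yx) _; rewrite mdistxx ltW.
  by move: fy; rewrite /f; have := mulr_ge0 (ltW k0) (mdist_ge0 y u); lra.
exists Y; split=> //; first by rewrite gapY subr_gt0.
apply: near_min_small_well_posed.
  by exists (a0, u); split=> //=; rewrite metric_sym ua0 gapY.
move=> h h0; have h20 : 0 < h / 2 by rewrite divr_gt0.
have uniq_a0 a : A a -> mdist a u <= mdist a0 u -> a = a0.
  rewrite [mdist a0 u]metric_sym [mdist a u]metric_sym ua0 => Aa ua.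
  have := metric_triangle x0 u a; have := gap_le Aa Xx0.
  rewrite -/l [mdist a x0]metric_sym => lx0a x0ua.
  apply: (geodesic_path_extend_unique cP (r := r)) => //.
  - by rewrite r0.
  - by lra.
  - by rewrite -/u; lra.
have [e1 e10 e1P] := unique_nearest_stable cA Aa0 uniq_a0 h20.
(* With tolerance [k * s], almost minimizing [y] lie within [s] of [u], so [a] is within
   [l - r + k * s + s] of [u], at most [e1] above the minimum; two such [y] are at most [h / 2]
   apart. *)
pose s := Num.min (Num.min (e1 / 2) (h / 4)) (e1 / 2 / k).
have s0 : 0 < s by rewrite !lt_min !divr_gt0.
have [se1 sh ske] : [/\ s <= e1 / 2, s <= h / 4 & k * s <= e1 / 2].
  by split; rewrite ?[k * s]mulrC -?ler_pdivlMr// !ge_min lexx ?orbT.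
have near_a0u a y : A a -> f y <= r -> mdist a y <= gap A Y + k * s ->
    mdist a0 a < h / 2 /\ mdist y u <= s.
  rewrite gapY => Aa fy ay; have ys : mdist y u <= s.
    by rewrite -(ler_pM2l k0); have := fA _ _ Aa fy; lra.
  split=> //; apply: e1P => //; rewrite [mdist a0 u]metric_sym ua0.
  by have := metric_triangle a y u; lra.
exists (k * s); first by rewrite mulr_gt0.
move=> a a' y y' Aa Aa' Yy Yy' ay ay'.
have [a0a yu] := near_a0u _ _ Aa Yy ay.
have [a0a' yu'] := near_a0u _ _ Aa' Yy' ay'.
have := metric_triangle a a0 a'; have := metric_triangle y u y'.
by rewrite [mdist a a0]metric_sym [mdist u y']metric_sym; split; lra.
Qed.

End perturbation.

(** * Density and the G-delta property *)

Theorem theorem4p2 (R : realType) (E : metricType R)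
    (geodE : geodesic_space E) (reflE : reflexive_space E)
    (convE : convex_metric E) (nobifE : no_bifurcating_geodesics E)
    (A : set E) (cpA : P_cp E A) :
  dense (W_min A) /\ Gdelta (W_min A).
Proof.
have [A0 _] := cpA; split.
  move=> O [X OX] [B oB BE]; rewrite -{}BE /= in OX *.
  (* By definition of the closure, [B] contains a set with positive gap, to which the perturbation
     applies. *)
  have /(_ B)[|X' [gX' BX']] := set_valP X; first exact: open_nbhs_nbhs.
  have : nbhs X' B by exact: open_nbhs_nbhs.
  move=> /metricType_numDomainType.nbhs_mdistP[e /= e0 eB].
  rewrite /= gap_sym in gX'.
  pose r := Num.min (e / 2) (gap A X' / 2).
  have [r0 re rg] : [/\ 0 < r, r <= e / 2 & r <= gap A X' / 2].
    by rewrite lt_min !divr_gt0//; split=> //; rewrite ge_min lexx ?orbT.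
  have r0g : 0 < r < gap A X' by rewrite r0; lra.
  have [Y [XY gY wY]] :=
    well_posed_perturbation geodE convE reflE nobifE cpA r0g.
  have PY : P_b_cl_cv_A A Y by apply: subset_closure; rewrite /= gap_sym.
  exists (exist _ Y (mem_set PY)); split=> //=.
  by apply: eB; rewrite /=; lra.
(* Interiors are taken because stability under perturbation loses a factor 2; a well-posed [X]
   satisfies the condition at half the size too, so it is an interior point. *)
pose V n := [set X : bclcv E | near_min_small A X n.+1%:R^-1]°.
exists (fun n => set_val @^-1` V n).
  by move=> n; exists (V n) => //; exact: open_interior.
apply/seteqP; split=> X.
  move=> wX n _; apply: near_min_small_nbhs => //.
  by apply: well_posed_near_min_small; rewrite ?divr_gt0 ?invr_gt0.
move=> FX; apply: near_min_small_well_posed.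
  exact: min_solution_exists.
move=> h h0.
have [n _ /(_ n (leqnn n)) /= nh] := near_infty_natSinv_lt (PosNum h0).
have [e e0 eP] := interior_subset (FX n I); exists e => // a a' x x' *.
by split; apply: (lt_trans _ nh); have [] := eP a a' x x'.
Qed.
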